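(* Let $0<R<1$ and $0<\epsilon<\frac{R(1-R)}{4}$ be real constants and let $\ell\ge2$, $s\ge1$ be integer constants. If $k,n$ are sufficiently large (in terms of $R,\epsilon,\ell,s$) positive integers with $\frac{k}{sn}=R$, then for every finite field $\mathbb{F}_q$ with $q>sn$, every generator $\gamma$ of $\mathbb{F}_q^\times$ and every appropriate $(\alpha_1,\dots,\alpha_n)\in\mathbb{F}_q^n$, the folded Reed--Solomon code $\mathsf{FRS}^{(s,\gamma)}_{n,k}(\alpha_1,\dots,\alpha_n)$ (of rate $R$) is not $\left(1-R-\epsilon,\ \ell,\ \ell^{\frac{R}{2\epsilon}-1}-1\right)$ list-recoverable.
   Context: Appropriate: $(\alpha_1,\dots,\alpha_n)\in\mathbb{F}_q^n$ is appropriate (with respect to $s$ and the generator $\gamma$) if the $sn$ elements $\gamma^i\alpha_j$, $i\in\{0,\dots,s-1\}$, $j\in\{1,\dots,n\}$, are pairwise distinct. Folded Reed--Solomon code: $\mathsf{FRS}^{(s,\gamma)}_{n,k}(\alpha_1,\dots,\alpha_n)=\{\mathcal{C}(f): f\in\mathbb{F}_q[x],\ \deg f<k\}\subseteq(\mathbb{F}_q^s)^n$, where $\mathcal{C}(f)=(F_1,\dots,F_n)$ and $F_i=(f(\alpha_i),f(\gamma\alpha_i),\dots,f(\gamma^{s-1}\alpha_i))\in\mathbb{F}_q^s$. The definition presupposes $q>sn>k$; the rate is $R=\frac{k}{sn}$. List-recoverability: for real $\rho\in[0,1]$ and real $L\ge0$, a code $C\subseteq\Sigma^n$ is $(\rho,\ell,L)$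 list-recoverable if for all subsets $S_1,\dots,S_n\subseteq\Sigma$ with $|S_i|\le\ell$ for every $i$, there are at most $L$ codewords $c\in C$ such that the number of indices $i\in\{1,\dots,n\}$ with $c_i\notin S_i$ is at most $\rho n$. *)

(* Defs.v *)
From HB Require Import structures.
From mathcomp Require Import all_boot all_order all_algebra.
From mathcomp Require Import all_fingroup all_solvable.
From mathcomp Require Import reals exp.

Set Implicit Arguments.
Unset Strict Implicit.
Unset Printing Implicit Defensive.

Import Order.TTheory GRing.Theory Num.Theory.
Local Open Scope ring_scope.

Definition appropriate (F : finFieldType) (s n : nat) (gamma : F)
    (alpha : 'rV[F]_n) : Prop :=
  injective (fun ij : 'I_s * 'I_n => gamma ^+ ij.1 * alpha 0 ij.2).

Definition frs_encode (F : finFieldType) (s n : nat) (gamma : F)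
    (alpha : 'rV[F]_n) (f : {poly F}) : {ffun 'I_n -> 'rV[F]_s} :=
  [ffun j => \row_(i < s) f.[gamma ^+ i * alpha 0 j]].

(* [{poly_k F}] is the finite type of polynomials of size at most [k], that is,
   of degree < k (zero included). *)
Definition FRS (F : finFieldType) (s n k : nat) (gamma : F)
    (alpha : 'rV[F]_n) : {set {ffun 'I_n -> 'rV[F]_s}} :=
  [set frs_encode s gamma alpha (val f) | f : {poly_k F}].

Definition list_recoverable (R : realType) (Sigma : finType) (n : nat)
    (C : {set {ffun 'I_n -> Sigma}}) (rho : R) (l : nat) (L : R) : Prop :=
  forall S : 'I_n -> {set Sigma}, (forall i, #|S i| <= l)%N ->
    #|[set c in C | #|[set i | c i \notin S i]|%:R <= rho * n%:R]|%:R <= L.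

(* Main.v *)
(** Split a set of slightly more than [(r + eps) * n] positions into [m] blocks
    of more than [eps * n] positions each, and let [P_j] be the monic polynomial
    vanishing exactly at the points of all the blocks other than the [j]-th.  The
    sizes are such that [P_j] has degree less than [k].  For [l] distinct scalars
    [a_0, .., a_(l-1)], the [l ^ m] polynomials [\sum_j a_(c j) *: P_j] restrict
    on the [j]-th block to [a_(c j) *: P_j], so that only [l] symbols occur at
    each position of the blocks; and since [P_j] does not vanish on the [j]-th
    block, the corresponding codewords are distinct. *)
Require Import Defs.
From HB Require Import structures.
From mathcomp Require Import all_boot all_order all_algebra.
From mathcomp Require Import all_fingroup all_solvable.
From mathcomp Require Import reals exp.
From mathcomp Require Import lra.

Import Order.TTheory GRing.Theory Num.Theory.
Local Open Scope ring_scope.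

Lemma card_ord_ltn (n t : nat) :
  (t <= n)%N -> #|[set i : 'I_n | (i < t)%N]| = t.
Proof.
move=> t_n; rewrite -sum1dep_card -(big_ord_widen n (fun=> 1%N) t_n).
by rewrite sum1_card card_ord.
Qed.

(** The [b] indices [x * m + j] with [x < b] are distinct and lie below [m * b]. This bounds the
    size of each block from below. *)
Lemma card_residue_class_ge (n t m b : nat) (j : 'I_m) :
  (m * b <= t)%N -> (t <= n)%N ->
  (b <= #|[set i : 'I_n | (i < t) && (i %% m == j)]|)%N.
Proof.
move=> mb_t t_n.
have lt_t (x : 'I_b) : (x * m + j < t)%N.
  apply: leq_trans mb_t; apply: (@leq_trans (x.+1 * m)).
    by rewrite mulSn addnC ltn_add2r.
  by rewrite mulnC leq_mul2l ltn_ord orbT.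
pose h (x : 'I_b) : 'I_n := Ordinal (leq_trans (lt_t x) t_n).
have h_inj : injective h.
  move=> x y /(congr1 val) /= /addIn /eqP.
  rewrite eqn_pmul2r; first by move/eqP/val_inj.
  exact: leq_ltn_trans (leq0n j) (ltn_ord j).
rewrite -[X in (X <= _)%N]card_ord -(card_imset predT h_inj).
apply/subset_leq_card/subsetP => _ /imsetP[x _ ->].
by rewrite inE /= lt_t modnMDl modn_small ?ltn_ord ?eqxx.
Qed.

Section LargeList.
Variables (F : finFieldType) (s n k l m b t : nat) (gamma : F).
Variable alpha : 'rV[F]_n.
Hypotheses (s_gt0 : (0 < s)%N) (b_gt0 : (0 < b)%N) (m_gt0 : (0 < m)%N).
Hypotheses (l_F : (l <= #|F|)%N) (mb_t : (m * b <= t)%N) (t_n : (t <= n)%N).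
Hypothesis stb_k : (s * (t - b) < k)%N.
Hypothesis alphaP : appropriate s gamma alpha.

Let point (p : 'I_s * 'I_n) : F := gamma ^+ p.1 * alpha 0 p.2.

(** Blocks are residue classes modulo [m], so all [t] positions are covered even if [m] does not
    divide [t]. *)
Let block (i : 'I_n) : 'I_m := Ordinal (ltn_pmod i m_gt0).

Let roots_of (j : 'I_m) : {set 'I_s * 'I_n} :=
  setX [set: 'I_s] [set i : 'I_n | (i < t)%N && (block i != j)].

Let block_poly (j : 'I_m) : {poly F} :=
  \prod_(p in roots_of j) ('X - (point p)%:P).

Let scalar (u : 'I_l) : F := enum_val (widen_ord l_F u).

Let list_poly (c : {ffun 'I_m -> 'I_l}) : {poly F} :=
  \sum_j scalar (c j) *: block_poly j.

Let symbols (i : 'I_n) : {set 'rV[F]_s} :=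
  [set \row_(i' < s) (scalar u * (block_poly (block i)).[point (i', i)])
     | u : 'I_l].

Let scalar_inj : injective scalar.
Proof. by move=> u v /enum_val_inj /(congr1 val) /= /val_inj. Qed.

(** There are [s] roots for each of the at most [t - b] positions outside block [j], so the degree
    is at most [s * (t - b)]. *)
Let size_block_poly (j : 'I_m) : (size (block_poly j) <= k)%N.
Proof.
rewrite /block_poly -big_enum /= size_prod_XsubC -cardE.
apply: leq_trans stb_k; rewrite ltnS cardsX cardsT card_ord leq_mul2l.
apply/orP; right.
pose T := [set i : 'I_n | (i < t)%N].
pose B := [set i : 'I_n | (i < t)%N && (i %% m == j)%N].
have -> : [set i : 'I_n | (i < t)%N && (block i != j)] = T :\: B.
  by apply/setP => i; rewrite !inE -val_eqE /=; case: (i < t)%N; rewrite ?andbT.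
have sBT : B \subset T by apply/subsetP => i; rewrite !inE => /andP[].
rewrite cardsD (setIidPr sBT) card_ord_ltn //.
by apply: leq_sub2l; apply: card_residue_class_ge mb_t t_n.
Qed.

(** Appropriateness makes distinct index pairs give distinct points, which excludes accidental
    roots. *)
Let block_poly_root (j : 'I_m) (p : 'I_s * 'I_n) :
  root (block_poly j) (point p) = (p \in roots_of j).
Proof.
apply/rootP/idP => [|pj]; last first.
  by rewrite horner_prod (bigD1 p) //= hornerXsubC subrr mul0r.
move/eqP; rewrite horner_prod prodf_seq_eq0 => /hasP[q _ /andP[qj]].
by rewrite hornerXsubC subr_eq0 => /eqP /alphaP ->.
Qed.

Let list_poly_block (c : {ffun 'I_m -> 'I_l}) (p : 'I_s * 'I_n) :
  (p.2 < t)%N ->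
  (list_poly c).[point p] =
    scalar (c (block p.2)) * (block_poly (block p.2)).[point p].
Proof.
move=> pt; rewrite /list_poly horner_sum (bigD1 (block p.2)) //= hornerZ.
rewrite big1 ?addr0 // => j jp; rewrite hornerZ.
have /rootP -> : root (block_poly j) (point p); last by rewrite mulr0.
by rewrite block_poly_root !inE pt eq_sym jp.
Qed.

Let size_list_poly c : (size (list_poly c) <= k)%N.
Proof.
apply: leq_trans (size_sum _ _ _) _; apply/bigmax_leqP => j _.
exact: leq_trans (size_scale_leq _ _) (size_block_poly j).
Qed.

Let encode c := frs_encode s gamma alpha (list_poly c).

Let encode_inj : injective encode.
Proof.
move=> c d /ffunP cd; apply/ffunP => j.
have j_t : (j < t)%N.
  apply: leq_trans (ltn_ord j) (leq_trans _ mb_t).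
  by rewrite leq_pmulr.
(* Since [j < m], position [j] itself lies in block [j]; its first coordinate already determines
   [c j]. *)
pose i : 'I_n := Ordinal (leq_trans j_t t_n).
pose p := (Ordinal s_gt0, i).
have bi : block p.2 = j by apply: val_inj; rewrite /= modn_small.
have := congr1 (fun v : 'rV_s => v 0 p.1) (cd i).
rewrite !ffunE !mxE -/(point p) !list_poly_block // bi.
have /mulIf inj : (block_poly j).[point p] != 0.
  by rewrite -/(root _ _) block_poly_root !inE bi eqxx andbF.
by move/inj/scalar_inj.
Qed.

Lemma FRS_large_list :
  exists S : 'I_n -> {set 'rV[F]_s}, (forall i, #|S i| <= l)%N /\
    (l ^ m <= #|[set c in FRS s k gamma alpha |
                 (#|[set i | c i \notin S i]| <= n - t)%N]|)%N.
Proof.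
exists symbols; split=> [i|].
  by apply: leq_trans (leq_imset_card _ _) _; rewrite card_ord.
rewrite -[X in (X ^ _)%N]card_ord -[X in (_ ^ X)%N]card_ord -card_ffun.
rewrite -(card_imset predT encode_inj).
apply/subset_leq_card/subsetP => _ /imsetP[c _ ->]; rewrite inE.
apply/andP; split.
  have sc : list_poly c \is a poly_of_size k by rewrite qualifE /= size_list_poly.
  by apply/imsetP; exists (Sub (list_poly c) sc); rewrite // SubK.
(* Disagreement is possible only at the positions from [t] on. *)
have -> : (n - t)%N = #|~: [set i : 'I_n | (i < t)%N]|.
  by rewrite cardsCs setCK card_ord card_ord_ltn.
apply/subset_leq_card/subsetP => i; rewrite !inE; apply: contra => i_t.
apply/imsetP; exists (c (block i)) => //; apply/rowP => i'.
by rewrite !ffunE !mxE -/(point (i', i)) list_poly_block.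
Qed.

End LargeList.

Theorem corollary1p9 (R : realType) (r eps : R) (l s : nat)
    (r_gt0 : 0 < r) (r_lt1 : r < 1)
    (eps_gt0 : 0 < eps) (eps_lt : eps < r * (1 - r) / 4)
    (l_ge2 : (2 <= l)%N) (s_ge1 : (1 <= s)%N) :
  exists N : nat, forall k n : nat,
    (0 < k)%N -> (0 < n)%N -> (N <= k)%N -> (N <= n)%N ->
    k%:R / (s * n)%:R = r ->
    forall (F : finFieldType) (gamma : {unit F}) (alpha : 'rV[F]_n),
      (s * n < #|F|)%N ->
      generator [set: {unit F}] gamma ->
      appropriate s (FinRing.uval gamma) alpha ->
      ~ list_recoverable (FRS s k (FinRing.uval gamma) alpha)
          (1 - r - eps) l (l%:R `^ (r / (2 * eps) - 1) - 1).
Proof.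
(* [l <= n] supplies [l] distinct scalars, as [n <= s * n < #|F|]; [n >= 2 / eps] absorbs the
   rounding in [b]. *)
exists (maxn l (Num.truncn (2 / eps)).+1) => k n k_gt0 n_gt0 _.
rewrite geq_max => /andP[l_n eps_n] kr F gamma alpha sn_F _ alphaP lr.
have n_pos : 0 < n%:R :> R by rewrite ltr0n.
have s_pos : 0 < s%:R :> R by rewrite ltr0n.
have epsn_ge2 : 2 <= eps * n%:R.
  rewrite mulrC -ler_pdivrMr // ltW //.
  have /andP[_ /lt_le_trans] : _ := truncn_itv (ltW (divr_gt0 (ltr0n R 2) eps_gt0)).
  by apply; rewrite ler_nat.
(* Rounding [t] up keeps [n - t] below [(1 - r - eps) * n]. The extra unit in [b] offsets this
   rounding, so [t - b < r * n], while [b <= eps * n + 2 <= 2 * eps * n] still holds. *)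
pose t := (Num.truncn ((r + eps) * n%:R)).+1.
pose b := (Num.truncn (eps * n%:R)).+2.
pose m := (t %/ b)%N.
have t_gt : (r + eps) * n%:R < t%:R by apply: truncnS_gt.
have t_le : t%:R <= (r + eps) * n%:R + 1.
  rewrite -natr1 lerD2r truncn_le; nra.
have b_gt : eps * n%:R + 1 < b%:R by rewrite -natr1 ltrD2r truncnS_gt.
have b_le : b%:R <= 2 * eps * n%:R.
  have : (Num.truncn (eps * n%:R))%:R <= eps * n%:R by rewrite truncn_le; lra.
  rewrite /b -!natr1; lra.
have reps_lt1 : r + eps < 1 by nra.
have t_n : (t <= n)%N.
  rewrite truncn_lt_nat; first by rewrite gtr_pMl.
  by apply: mulr_ge0; lra.
have mb_t : (m * b <= t)%N by apply: leq_divM.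
(* From [(r + eps) * n < t < (m + 1) * b <= (m + 1) * (2 * eps * n)], after dividing by
   [2 * eps * n]. *)
have m_gt : r / (2 * eps) - 1 < m%:R.
  have : (t%:R < (m%:R + 1) * b%:R :> R).
    by rewrite natr1 -natrM ltr_nat ltn_ceil.
  rewrite ltrBlDr ltr_pdivrMr; last lra.
  have m_ge0 : 0 <= m%:R :> R by [].
  move=> tmb.
  have : (m%:R + 1) * b%:R <= (m%:R + 1) * (2 * eps * n%:R) by apply: ler_wpM2l; lra.
  move=> mbn; rewrite -(ltr_pM2r n_pos).
  have : 0 < eps * n%:R by lra.
  lra.
have m_gt0 : (0 < m)%N.
  rewrite -(ltr_nat R); apply: le_lt_trans m_gt.
  by rewrite subr_ge0 ler_pdivlMr; nra.
have stb_k : (s * (t - b) < k)%N.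
  rewrite -(ltr_nat R).
  have -> : k%:R = r * (s%:R * n%:R).
    by rewrite -kr natrM divfK // mulf_neq0 // gt_eqF.
  rewrite natrM mulrCA ltr_pM2l //.
  (* If [t <= b], the truncated difference is [0]. *)
  have [tb|/ltnW bt] := leqP t b.
    by rewrite (eqP tb) mulr_gt0.
  rewrite natrB //; lra.
have l_F : (l <= #|F|)%N.
  apply: leq_trans l_n (leq_trans _ (ltnW sn_F)); exact: leq_pmull.
have [S [S_l S_large]] :=
  FRS_large_list _ _ _ _ _ _ _ _ _ _ s_ge1 (isT : (0 < b)%N) m_gt0 l_F mb_t t_n stb_k alphaP.
have := lr S S_l; apply/negP; rewrite -ltNge.
apply: (@lt_le_trans _ _ (l ^ m)%:R).
  apply: (@lt_le_trans _ _ (l%:R `^ (r / (2 * eps) - 1))).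
    by rewrite ltrBlDr ltrDl.
  rewrite natrX -powR_mulrn ?ler0n // ler_powR ?ler1n 1?ltnW //.
  exact: ltW.
rewrite ler_nat; apply: leq_trans S_large _.
apply/subset_leq_card/subsetP => c; rewrite !inE => /andP[-> c_t] /=.
apply: (@le_trans _ _ (n - t)%:R); first by rewrite ler_nat.
rewrite natrB //; lra.
Qed.
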